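(* Let $G$ be a connected graph on $d$ vertices that is not a complete graph. In the Hüsler--Reiss graphical model specified by $G$, the extremal maximum likelihood threshold is bounded by $$q(G)-1\ \le\ \operatorname{eMLT}(G)\ \le\ \operatorname{tw}(G).$$
   Context: Graphs are finite, simple, undirected, with vertex set $[d]$. The clique number $q(G)$ is the number of vertices in the largest complete subgraph of $G$. A chordal cover of $G=(V,E)$ is a chordal graph $G'=(V,E')$ with $E\subset E'$. The treewidth is $\operatorname{tw}(G)=q(G')-1$, where $G'$ is a chordal cover of $G$ with the smallest clique number. A variogram matrix (Euclidean distance matrix) is a symmetric $d\times d$ matrix whose $ij$ entry is the squared Euclidean distance between the $i$th and $j$th point of some configuration of $d$ points in a Euclidean space; its dimensionality is the minimal $m$ such that the points can be taken in $\mathbb{R}^m$. Equivalently, it is $\gamma(\Sigma)=d_\Sigma\mathbf{1}^\top+\mathbf{1}d_\Sigma^\top-2\Sigma$ for a positive semidefinite $\Sigma$ of rank $m$ with $\Sigma\mathbf{1}=\mathbf{0}$, where $d_\Sigma$ is the vector of diagonal entries of $\Sigma$. A generic (empirical) variogram matrix of dimensionality $m$ is one arising from a generic such $\Sigma$ of rank $m$ (a property holds generically if it holds with probability one, i.e. for almost all such matrices). A real symmetric zero-diagonal matrix $\Gamma$ is strictly conditionally negative definite (CND) if $v^\top\Gamma v<0$ for all $v\neq\mathbf{0}$ with $v\perp\mathbf{1}$. A strictly CND completion of $\overline\Gamma$ (with respect to $G$) is a strictly CND matrix $\Gamma$ with $\Gamma_{ij}=\overline\Gamma_{ij}$ for all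 edges $(i,j)$ of $G$. The extremal maximum likelihood threshold $\operatorname{eMLT}(G)$ is the minimum $m$ such that a generic empirical variogram matrix of dimensionality $m$ admits a strictly CND completion. *)

(* Defs.v *)
From HB Require Import structures.
From mathcomp Require Import all_boot all_order all_algebra.
From mathcomp Require Import ring.
From mathcomp Require Import all_classical all_reals all_analysis.
Set Implicit Arguments.
Unset Strict Implicit.
Unset Printing Implicit Defensive.
Import Order.TTheory GRing.Theory Num.Theory.
Local Open Scope ring_scope.

Record graph (d : nat) := Graph {
  edges :> {set {set 'I_d}};
  edges_card2 : [forall e in edges, #|e| == 2%N]
}.

HB.instance Definition _ d := [isSub for @edges d].
HB.instance Definition _ d := [Finite of graph d by <:].

Section Graphs.
Variable d : nat.
Implicit Types G H : graph d.

(* Irreflexive: [set i; i] has cardinality 1, hence is never an edge. *)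
Definition adj G : rel 'I_d := fun i j => [set i; j] \in edges G.

Definition connected_graph G : Prop := forall i j, connect (adj G) i j.

Definition clique G (S : {set 'I_d}) : bool :=
  [forall i in S, forall j in S, (i != j) ==> adj G i j].

Definition is_complete G : Prop := clique G [set: 'I_d].

Definition clique_number G : nat := \max_(S : {set 'I_d} | clique G S) #|S|.

(* Every cycle on at least four (distinct) vertices has a chord, i.e. an edge
   joining two vertices that are not consecutive on the cycle. *)
Definition chordal G : Prop :=
  forall c : seq 'I_d, (4 <= size c)%N -> ucycle (adj G) c ->
  exists i j, [/\ i \in c, j \in c, adj G i j, j != next c i & i != next c j].

Definition chordal_cover G H : bool := `[< edges G \subset edges H /\ chordal H >].

Lemma complete_edges_card2 :
  [forall e in [set e : {set 'I_d} | #|e| == 2%N], #|e| == 2%N].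
Proof. by apply/forall_inP => e; rewrite inE. Qed.

Definition complete_graph : graph d := Graph complete_edges_card2.

Lemma chordal_cover_complete G : chordal_cover G complete_graph.
Proof.
apply/asboolP; split.
  apply/fintype.subsetP => e eG; rewrite inE.
  by move/forall_inP: (edges_card2 G); apply.
case=> [|a [|b [|c [|e s]]]]//= _ /andP[_ /=] /andP[].
rewrite !inE !negb_or => /and4P[ab ac ae _] /andP[/and3P[bc _ _] _].
exists a, c; rewrite /adj !inE !cards2 !eqxx ac !orbT /=.
by split; rewrite // ?eqxx ?(eq_sym c) ?(negbTE ac) ?(negbTE bc) /= ?eqxx.
Qed.

(* [arg min] takes a default satisfying the constraint: see
   [chordal_cover_complete]. *)
Definition treewidth G : nat :=
  (clique_number
     [arg min_(H < complete_graph | chordal_cover G H) clique_number H]).-1.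

End Graphs.

(* The n-dimensional Lebesgue measure, on n.-tuple R with its product
   sigma-algebra, as the n-fold product of the one on R. *)
Section LebesgueTuple.
Local Open Scope classical_set_scope.
Variable R : realType.

Let T := measurableTypeR R.

Definition tuple_cons n (p : n.-tuple T * T) : n.+1.-tuple T :=
  [tuple of p.2 :: p.1].

Lemma measurable_tuple_cons n : measurable_fun setT (@tuple_cons n).
Proof. exact: measurable_cons. Qed.

Definition lebesgue_step n (mu : {measure set (n.-tuple T) -> \bar R}) :
    set (n.+1.-tuple T) -> \bar R :=
  pushforward (mu \x @lebesgue_measure R)%E (@tuple_cons n).

Section LebesgueStep.
Variables (n : nat) (mu : {measure set (n.-tuple T) -> \bar R}).

Let step0 : lebesgue_step mu set0 = 0%E.
Proof. by rewrite /lebesgue_step /pushforward preimage_set0 measure0. Qed.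

Let step_ge0 A : (0 <= lebesgue_step mu A)%E.
Proof. exact: (@measure_ge0 _ _ _ (mu \x @lebesgue_measure R)%E). Qed.

Let step_sigma_additive : semi_sigma_additive (lebesgue_step mu).
Proof.
have mcons A : measurable A -> measurable (@tuple_cons n @^-1` A).
  by move=> mA; rewrite -[X in measurable X]setTI; exact: measurable_tuple_cons.
move=> F mF tF mUF; rewrite /lebesgue_step /pushforward preimage_bigcup.
apply: (@measure_semi_sigma_additive _ _ _ (mu \x @lebesgue_measure R)%E).
- by move=> i; exact: mcons.
- apply/trivIsetP => /= i j _ _ ij; rewrite -preimage_setI.
  by move/trivIsetP : tF => /(_ _ _ _ _ ij) ->//; rewrite preimage_set0.
- by rewrite -preimage_bigcup; exact: mcons.
Qed.

HB.instance Definition _ := isMeasure.Build _ _ _ (lebesgue_step mu)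
  step0 step_ge0 step_sigma_additive.
End LebesgueStep.

Fixpoint lebesgue_tuple n : {measure set (n.-tuple T) -> \bar R} :=
  match n with
  | 0 => \d_([tuple] : 0.-tuple T)
  | n'.+1 => @lebesgue_step n' (lebesgue_tuple n')
  end.

End LebesgueTuple.

Section Variograms.
Local Open Scope classical_set_scope.
Variables (R : realType) (d : nat).
Implicit Types (Sigma Gamma : 'M[R]_d) (v : 'cV[R]_d).

Definition variogram Sigma : 'M[R]_d :=
  \matrix_(i, j) (Sigma i i + Sigma j j - 2 * Sigma i j).

Definition psd Sigma : Prop :=
  Sigma^T = Sigma /\ forall v, 0 <= (v^T *m Sigma *m v) 0 0.

Definition centered_psd_of_rank (m : nat) Sigma : Prop :=
  [/\ psd Sigma, Sigma *m const_mx 1 = 0 :> 'cV[R]_d & \rank Sigma = m].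

Definition strictly_cnd Gamma : Prop :=
  [/\ Gamma^T = Gamma, (forall i, Gamma i i = 0) &
      forall v, v != 0 -> \sum_i v i 0 = 0 -> (v^T *m Gamma *m v) 0 0 < 0].

Definition strictly_cnd_completion (G : graph d) Gammabar Gamma : Prop :=
  strictly_cnd Gamma /\ forall i j, adj G i j -> Gamma i j = Gammabar i j.

Definition centering : 'M[R]_d := 1%:M - const_mx d%:R^-1.

(* The Gram matrix of the points given by the rows of X, translated so that
   their barycenter is the origin. *)
Definition centered_gram m (X : 'M[R]_(d, m)) : 'M[R]_d :=
  (centering *m X) *m (centering *m X)^T.

(* Hence [variogram (centered_gram X)] is the Euclidean distance matrix of the
   rows of X. *)
Lemma variogram_centered_gram m (X : 'M[R]_(d, m)) i j :
  variogram (centered_gram X) i j = \sum_k (X i k - X j k) ^+ 2.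
Proof.
rewrite !mxE mulr_sumr -big_split -sumrB /=; apply: eq_bigr => k _.
have cE l : (centering *m X) l k = X l k - \sum_h d%:R^-1 * X h k.
  rewrite /centering mulmxBl mul1mx !mxE; congr (_ - _).
  by apply: eq_bigr => h _; rewrite mxE.
rewrite ![_^T _ _]mxE !cE.
set s := \sum_h _.
by rewrite -[in LHS]expr2; ring.
Qed.

Definition config m (t : (d * m).-tuple (measurableTypeR R)) : 'M[R]_(d, m) :=
  vec_mx (\row_k tnth t k).

(* P holds for almost all positive semidefinite Sigma of rank m with
   Sigma 1 = 0. The null sets of this family of matrices (for m < d, those of
   a smooth manifold) are defined by parametrization: X |-> centered_gram X maps
   the d x m matrices onto the matrices of the family of rank at most m, and
   is a submersion above those of rank m, so that a set of matrices of rank m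
   is null iff its preimage is Lebesgue-null. *)
Definition generically (m : nat) (P : 'M[R]_d -> Prop) : Prop :=
  (lebesgue_tuple R (d * m)).-negligible
    [set t | let Sigma := centered_gram (config t) in
             centered_psd_of_rank m Sigma /\ ~ P Sigma].

(* The bound m < d excludes the m for which no variogram of dimensionality m
   exists, for which [generically m] would hold vacuously. *)
Definition generically_completable (G : graph d) (m : nat) : Prop :=
  (m < d)%N /\
  generically m (fun Sigma =>
    exists Gamma, strictly_cnd_completion G (variogram Sigma) Gamma).

Definition is_eMLT (G : graph d) (m : nat) : Prop :=
  generically_completable G m /\
  forall k, generically_completable G k -> (m <= k)%N.

End Variograms.

(* Main.v *)
Require Import Defs.
From mathcomp Require Import all_boot all_order all_algebra.
From mathcomp Require Import ring.
From mathcomp Require Import all_classical all_reals all_analysis measurable_realfun.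
Set Implicit Arguments.
Unset Strict Implicit.
Unset Printing Implicit Defensive.
Import Order.TTheory GRing.Theory Num.Theory.

(** A variogram is the matrix of squared distances between the rows x_i of a
    d x m matrix X, and for a vector u whose coordinates sum to 0 its quadratic
    form takes the value - 2 |\sum_i u_i x_i|^2 ([quad_sqdist]). Strict
    conditional negative definiteness on a set of indices therefore says that
    the corresponding points are affinely independent, and both bounds are
    statements about affine independence.

    Lower bound. A clique with more than m + 1 vertices has affinely dependent
    points in R^m. A dependence u supported on the clique only sees entries of
    the variogram that every completion has to keep, so each completion has
    value 0 at u and none is strictly conditionally negative definite
    ([no_completion]). This happens for every configuration, so it remains to
    know that the configurations of rank m are not a null set.

    Upper bound. Take a chordal cover H of smallest clique number, tw(G) + 1. In
    a generic configuration in dimension tw(G), any tw(G) + 1 points are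
    affinely independent, hence the points of every clique of H are. Such a
    configuration can be completed: a chordal graph has a simplicial vertex v
    ([chordal_simplicial]); realise the other points by induction, and put the
    new point at the affine combination of its neighbours given by the
    orthogonal projection of x_v, lifted along a new coordinate axis by the
    distance from x_v to its projection. This keeps the distances from v to its
    neighbours, which form a clique, and the resulting points are linearly
    independent because the matrix is triangular in the order of insertion
    ([euclidean_completion]).

    Genericity. Affine independence of m + 1 chosen points is the nonvanishing
    of a determinant ([affine_minor]) that is affine in each of the d m
    coordinates, each coordinate occurring in a single row. The zeros of a
    nonzero function that is affine in each coordinate are Lebesgue-null, by
    induction on the number of coordinates and Fubini's theorem
    ([zeros_null]). *)

(** * Simplicial vertices of chordal graphs *)

Section Chordal.
Variables (d : nat) (G : graph d).
Implicit Types (T : {set 'I_d}) (v : 'I_d) (s : seq 'I_d).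

Lemma adjC : symmetric (adj G).
Proof. by move=> i j; rewrite /adj finset.setUC. Qed.

Lemma adjxx i : adj G i i = false.
Proof.
apply/negP => /(forall_inP (edges_card2 G)).
by rewrite finset.setUid cards1.
Qed.

Definition simplicial T v : Prop :=
  {in T &, forall a b, adj G v a -> adj G v b -> a != b -> adj G a b}.

(** A chord of the cycle v s v cannot end at v, whose only neighbours on the cycle
    are the two ends of s. So it bypasses a part of s, and s can be shortened
    with the same ends as long as these are not adjacent. *)
Lemma chordal_no_detour v x y s : chordal G ->
    path (adj G) v (rcons s v) -> uniq s -> v \notin s ->
    head v s = x -> last v s = y -> x != y -> ~~ adj G x y ->
  {in s, forall z, adj G v z -> z = x \/ z = y} -> False.
Proof.
move=> chG; have [n] := ubnP (size s); elim: n s => // n IHn s.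
rewrite ltnS => sn pvs us vs hs ls xy nxy svxy.
have sz4 : 4 <= size (v :: s).
  case: s {sn svxy us vs} pvs hs ls => [|a [|b [|c s]]] /=.
  - by move=> _ ax ay; rewrite -ax -ay eqxx in xy.
  - by move=> _ ax ay; rewrite -ax -ay eqxx in xy.
  - by move=> /and3P[_ ab _] ax yb; rewrite -ax -yb ab in nxy.
  - by [].
have ucs : ucycle (adj G) (v :: s) by rewrite /ucycle /= pvs vs us.
have [i [j [ic jc ij jni inj]]] := chG _ sz4 ucs.
have nextv : next (v :: s) v = x.
  by rewrite next_nth mem_head /= eqxx -hs; case: (s).
have nexty : next (v :: s) y = v.
  have ys : y \in v :: s by rewrite -ls mem_last.
  rewrite next_nth ys nth_default // -ls -[in index _ _](nth_last v) /=.
  have s0 : 0 < size s by case: (s) sz4.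
  have ns : nth v s (size s).-1 \in s by rewrite mem_nth // prednK.
  by rewrite ifN ?index_uniq ?prednK //; apply: contraNneq vs => ->.
have chord_v k : adj G v k -> k != next (v :: s) v -> v != next (v :: s) k ->
    k \in v :: s -> False.
  rewrite nextv inE => vk kx vnk /orP[/eqP kv|ks].
    by rewrite kv adjxx in vk.
  case: (svxy _ ks vk) => ek; first by rewrite ek eqxx in kx.
  by rewrite ek nexty eqxx in vnk.
have [iv|iv] := eqVneq i v.
  by move: ij jni inj; rewrite iv => vj jnv vnj; apply: (chord_v j).
have [jv|jv] := eqVneq j v.
  by move: ij jni inj; rewrite jv adjC => vi vni inv; apply: (chord_v i).
move: ic jc; rewrite !inE (negPf iv) (negPf jv) /= => is_ js_.
wlog lt_ij : i j ij jni inj {iv jv} is_ js_ / index i s < index j s => [IH|].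
  have [lt|lt|/(congr1 (nth v s))] := ltngtP (index i s) (index j s).
  - exact: (IH i j).
  - by apply: (IH j i) => //; rewrite adjC.
  - by rewrite !nth_index // => eij; rewrite eij adjxx in ij.
clear chord_v nextv nexty ucs sz4 inj.
case/splitPr: is_ us pvs vs hs ls sn svxy jni js_ lt_ij => s1 s4.
rewrite cat_uniq => /and3P[us1 s1s2 us4] pvs vs hs ls sn svxy jni js_.
have is1 : i \notin s1.
  by apply: contraNN s1s2 => is1; apply/hasP; exists i; rewrite ?mem_head.
rewrite !index_cat (negPf is1) /= eqxx addn0.
case: ifP => [js1 /(ltn_trans _)|js1 _].
  by move=> /(_ _ (etrans (index_mem _ _) js1)); rewrite ltnn.
move: js_; rewrite mem_cat js1 inE; have [eji|ji /= js2] := eqVneq j i.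
  by rewrite eji adjxx in ij.
case/splitPr: js2 us4 pvs vs hs ls sn svxy jni s1s2 => s2 s3.
move=> us4 pvs vs hs ls sn svxy jni s1s2.
have sub : subseq (s1 ++ i :: j :: s3) (s1 ++ i :: s2 ++ j :: s3).
  by rewrite cat_subseq //= eqxx suffix_subseq.
apply: (IHn (s1 ++ i :: j :: s3)).
- apply: leq_trans sn; rewrite !size_cat /= size_cat /= ltn_add2l ltnS.
  rewrite -[leqLHS]add1n leq_add2r lt0n size_eq0.
  apply: contraNneq jni => s2nil.
  rewrite s2nil next_nth inE mem_cat mem_head !orbT /=.
  rewrite ifN; last first.
    by apply: contraNneq vs => ->; rewrite mem_cat mem_head orbT.
  by rewrite index_cat (negPf is1) /= eqxx addn0 nth_cat ltnNge leqnSn subSnn.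
- move: pvs; rewrite !rcons_cat !cat_path /= !rcons_cat /= cat_path /= ij.
  by move=> /and4P[-> -> _] /andP[_ ->].
- by apply: (subseq_uniq sub); rewrite cat_uniq us1 s1s2.
- by apply: contraNN vs; apply: mem_subseq.
- by rewrite -hs; case: (s1).
- by rewrite -ls !last_cat /= last_cat /=.
- by [].
- by [].
- by move=> z zs; apply: svxy; apply: mem_subseq zs.
Qed.

(** Dirac's theorem, in a form that an induction on T can prove. Let U be the
    component of w in T minus the closed neighbourhood of v, and C the
    neighbours of v that touch U. Two nonadjacent vertices of C would be joined
    through U by a detour around v, so C is a clique. Either U and C together
    form a clique and w is simplicial, or the induction hypothesis for their
    union, at a well chosen vertex, yields a simplicial vertex in U. It remains
    simplicial in T because all neighbours of U lie in U or C. *)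
Lemma simplicial_outside_neighbourhood T v w : chordal G ->
    v \in T -> w \in T -> w != v -> ~~ adj G v w ->
  exists2 u, u \in T & [/\ u != v, ~~ adj G v u & simplicial T u].
Proof.
move=> chG; have [n] := ubnP #|T|; elim: n T v w => // n IHn T v w.
rewrite ltnS => Tn vT wT wv nvw.
pose W := [set z in T | (z != v) && ~~ adj G v z].
pose e := [rel a b | [&& adj G a b, a \in W & b \in W]].
have e_sym : symmetric e by move=> a b /=; rewrite adjC [(a \in W) && _]andbC.
have ce_sym : connect_sym e by apply: sym_connect_sym.
pose U := [set u | connect e w u].
have wU : w \in U by rewrite inE connect0.
have wW : w \in W by rewrite inE wT wv.
have UW u : u \in U -> u \in W.
  rewrite inE => /connectP[p + ->]; elim: p (w) wW => //= a p IHp z zW.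
  by move=> /andP[/and3P[_ _ aW] /IHp]; apply.
pose C := [set x in T | adj G v x && [exists u in U, adj G x u]].
have NU u z : u \in U -> z \in T -> adj G u z -> z \in U :|: C.
  move=> uU zT uz; have := UW _ uU; rewrite inE => /and3P[uT uv nvu].
  have zv : z != v by apply: contraNneq nvu => <-; rewrite adjC.
  have [vz|nvz] := boolP (adj G v z).
    rewrite inE [z \in C]inE zT vz /= orbC; apply/orP; left.
    by apply/exists_inP; exists u; rewrite // adjC.
  rewrite inE inE; apply/orP; left.
  have := uU; rewrite inE => /connect_trans; apply; apply: connect1.
  by rewrite /= uz UW //= inE zT zv.
have Cclique : {in C &, forall x y, x != y -> adj G x y}.
  move=> x y; rewrite !inE => /and3P[xT vx /exists_inP[a aU xa]].
  move=> /and3P[yT vy /exists_inP[b bU yb]] xy; apply/negP => /negP nxy.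
  have : connect e a b.
    rewrite (connect_trans (y := w)) //; first by rewrite ce_sym; rewrite inE in aU.
    by rewrite inE in bU.
  case/connectP => p0 /shortenP[p ep up _ lp].
  have pW : {subset a :: p <= W}.
    move=> z; rewrite inE => /orP[/eqP->|]; first exact: UW.
    elim: (p) (a) ep {lp up} => // h q IHq a' /= /andP[/and3P[_ _ hW] eq].
    by rewrite inE => /orP[/eqP->//|]; apply: IHq eq.
  have pN z : adj G v z -> (z \in a :: p) = false.
    by apply: contraTF => /pW; rewrite inE => /and3P[].
  have ap : path (adj G) a p by apply: sub_path ep => i j /and3P[].
  apply: (@chordal_no_detour v x y (x :: rcons (a :: p) y)) => //.
  - by rewrite /= vx xa !rcons_path ap /= -lp last_rcons adjC yb adjC vy.
  - by rewrite cons_uniq mem_rcons rcons_uniq inE negb_or xy !pN.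
  - rewrite in_cons mem_rcons in_cons; apply/norP; split; last (apply/norP; split).
    + by apply: contraTneq vx => <-; rewrite adjxx.
    + by apply: contraTneq vy => <-; rewrite adjxx.
    + by apply/negP => /pW; rewrite inE eqxx andbF.
  - by rewrite last_cons last_rcons.
  - move=> z; rewrite in_cons mem_rcons in_cons => /or3P[/eqP|/eqP|]; [by left|by right|].
    by move=> zp vz; rewrite pN in zp.
have vUC : v \notin U :|: C.
  rewrite inE negb_or; apply/andP; split.
    by apply/negP => /UW; rewrite inE eqxx andbF.
  by rewrite inE adjxx andbF.
have UCT : U :|: C \subset T.
  apply/fintype.subsetP => z; rewrite inE => /orP[/UW|]; rewrite inE => /andP[] //.
have UCn : #|U :|: C| < n.
  apply: leq_trans Tn; apply: proper_card; apply/properP; split => //.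
  by exists v.
suff [u uU simu] : exists2 u, u \in U & simplicial (U :|: C) u.
  have := UW _ uU; rewrite inE => /and3P[uT uv nvu].
  exists u => //; split => // a b aT bT ua ub.
  by apply: simu => //; apply: (NU u).
(* A nonneighbour of c : C cannot be in C, which is a clique. If C is joined to
   everything, a nonneighbour of a vertex of U cannot be in C either. *)
have [/exists_inP[c cC /exists_inP[z zUC /andP[zc ncz]]]|noC] :=
    boolP [exists c in C, exists z in U :|: C, (z != c) && ~~ adj G c z].
  have cUC : c \in U :|: C by rewrite inE cC orbT.
  have [u + [uc ncu simu]] := IHn _ c z UCn cUC zUC zc ncz.
  rewrite inE => /orP[uU|uC]; first by exists u.
  by rewrite Cclique // eq_sym in ncu.
have [/exists_inP[c cU /exists_inP[z zUC /andP[zc ncz]]]|noU] :=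
    boolP [exists c in U, exists z in U :|: C, (z != c) && ~~ adj G c z].
  have cUC : c \in U :|: C by rewrite inE cU.
  have [u uUC [uc ncu simu]] := IHn _ c z UCn cUC zUC zc ncz.
  have [uC|uC] := boolP (u \in C).
    case/negP: noC; apply/exists_inP; exists u => //.
    by apply/exists_inP; exists c => //; rewrite eq_sym uc adjC.
  by move: uUC; rewrite inE (negPf uC) orbF => uU; exists u.
exists w => // a b + bUC _ _ ab; rewrite inE.
have ba : b != a by rewrite eq_sym.
case/orP => aUC; apply/negPn/negP => nab.
  case/negP: noU; apply/exists_inP; exists a => //.
  by apply/exists_inP; exists b; rewrite // ba.
case/negP: noC; apply/exists_inP; exists a => //.
by apply/exists_inP; exists b; rewrite // ba.
Qed.

Lemma chordal_simplicial T : chordal G -> T != finset.set0 ->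
  exists2 v, v \in T & simplicial T v.
Proof.
move=> chG /set0Pn[v vT].
have [/exists_inP[c cT /exists_inP[z zT /andP[zc ncz]]]|complete] :=
    boolP [exists c in T, exists z in T, (z != c) && ~~ adj G c z].
  have [u uT [_ _ simu]] := simplicial_outside_neighbourhood chG cT zT zc ncz.
  by exists u.
exists v => // a b aT bT _ _ ab; apply/negPn/negP => nab.
case/negP: complete; apply/exists_inP; exists a => //.
by apply/exists_inP; exists b; rewrite // eq_sym ab.
Qed.

End Chordal.

Local Open Scope ring_scope.

(** * Scalar products, distances and affine projections *)

Section Euclid.
Variable R : realType.

Definition dot n (u v : 'rV[R]_n) : R := (u *m v^T) 0 0.
Definition sqnorm n (u : 'rV[R]_n) : R := dot u u.
Definition coord_sum n (u : 'rV[R]_n) : R := \sum_i u 0 i.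

Lemma dotE n (u v : 'rV[R]_n) : dot u v = \sum_i u 0 i * v 0 i.
Proof. by rewrite /dot mxE; apply: eq_bigr => i _; rewrite mxE. Qed.

Lemma sqnorm_ge0 n (u : 'rV[R]_n) : 0 <= sqnorm u.
Proof.
by rewrite /sqnorm dotE; apply: sumr_ge0 => i _; rewrite -expr2 sqr_ge0.
Qed.

Lemma sqnorm_eq0 n (u : 'rV[R]_n) : sqnorm u = 0 -> u = 0.
Proof.
rewrite /sqnorm dotE => /psumr_eq0P u0; apply/rowP => i; rewrite mxE.
apply/eqP; rewrite -sqrf_eq0 expr2 u0 // => j _.
by rewrite -expr2 sqr_ge0.
Qed.

Lemma dotC n (u v : 'rV[R]_n) : dot u v = dot v u.
Proof. by rewrite !dotE; apply: eq_bigr => i _; rewrite mulrC. Qed.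

Lemma dotDl n (u v w : 'rV[R]_n) : dot (u + v) w = dot u w + dot v w.
Proof. by rewrite /dot mulmxDl mxE. Qed.

Lemma sqnormD_orth n (u v : 'rV[R]_n) : dot u v = 0 ->
  sqnorm (u + v) = sqnorm u + sqnorm v.
Proof.
move=> uv; rewrite /sqnorm dotDl !(dotC _ (u + v)) !dotDl (dotC v u) uv.
by rewrite addr0 add0r.
Qed.

Lemma mulmx_tr_eq0 m n (u : 'rV[R]_m) (M : 'M[R]_(m, n)) :
  u *m (M *m M^T) = 0 -> u *m M = 0.
Proof.
move=> uMM; apply: sqnorm_eq0.
by rewrite /sqnorm /dot trmx_mul mulmxA -(mulmxA u) uMM mul0mx mxE.
Qed.

(** A vector killed by the Gram matrix has image of norm 0. *)
Lemma mxrank_gram m n (M : 'M[R]_(m, n)) : \rank (M *m M^T) = \rank M.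
Proof.
apply/eqP; rewrite eqn_leq mxrankM_maxl /=.
have : (\rank (kermx (M *m M^T)) <= \rank (kermx M))%N.
  apply/mxrankS/row_subP => i; apply/sub_kermxP.
  by apply: mulmx_tr_eq0; apply/sub_kermxP; apply: row_sub.
by rewrite !mxrank_ker leq_sub2lE ?rank_leq_row.
Qed.

(** The normal equations w (M M^T) = x M^T of a least-squares problem are always
    solvable, whether or not the rows of M are independent. *)
Lemma trmx_sub_gram m n (M : 'M[R]_(m, n)) : (M^T <= M *m M^T)%MS.
Proof.
by rewrite -(mxrank_leqif_sup (submxMl M M^T)) mxrank_gram mxrank_tr.
Qed.

End Euclid.

Section Points.
Variables (R : realType) (d : nat).
Implicit Types (K T : {set 'I_d}) (u c : 'rV[R]_d).

Definition supported K u := forall i, i \notin K -> u 0 i = 0.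

Definition affinely_independent m (X : 'M[R]_(d, m)) K :=
  forall u, supported K u -> u *m X = 0 -> coord_sum u = 0 -> u = 0.

Lemma coord_sumD u v : coord_sum (u + v) = coord_sum u + coord_sum v.
Proof. by rewrite /coord_sum -big_split; apply: eq_bigr => i _; rewrite mxE. Qed.

Lemma coord_sumN u : coord_sum (- u) = - coord_sum u.
Proof. by rewrite /coord_sum -sumrN; apply: eq_bigr => i _; rewrite mxE. Qed.

Lemma coord_sumB u v : coord_sum (u - v) = coord_sum u - coord_sum v.
Proof. by rewrite coord_sumD coord_sumN. Qed.

Lemma coord_sumZ a u : coord_sum (a *: u) = a * coord_sum u.
Proof. by rewrite /coord_sum mulr_sumr; apply: eq_bigr => i _; rewrite mxE. Qed.

Lemma coord_sum_delta i : coord_sum (delta_mx 0 i : 'rV[R]_d) = 1.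
Proof.
rewrite /coord_sum (bigD1 i) //= mxE !eqxx big1 ?addr0 // => j ji.
by rewrite mxE (negPf ji) andbF.
Qed.

Lemma supportedB K u v : supported K u -> supported K v -> supported K (u - v).
Proof. by move=> uK vK i iK; rewrite !mxE uK // vK // subr0. Qed.

Lemma supported_delta K i : i \in K -> supported K (delta_mx 0 i).
Proof.
by move=> iK j; rewrite mxE eqxx /= eq_sym; have [<-|] := eqVneq; rewrite // iK.
Qed.

Lemma supportedS K T u : K \subset T -> supported K u -> supported T u.
Proof.
by move=> /fintype.subsetP KT uK i iT; apply: uK; apply: contra iT => /KT.
Qed.

Definition sqdist m (X : 'M[R]_(d, m)) i j : R := sqnorm (row i X - row j X).

Lemma variogram_gram m (X : 'M[R]_(d, m)) i j :
  variogram (X *m X^T) i j = sqdist X i j.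
Proof.
rewrite /sqdist /sqnorm dotE !mxE mulr_sumr -big_split -sumrB /=.
by apply: eq_bigr => k _; rewrite !mxE; ring.
Qed.

Lemma variogram_centered_gram_sqdist m (X : 'M[R]_(d, m)) i j :
  variogram (centered_gram X) i j = sqdist X i j.
Proof.
rewrite variogram_centered_gram /sqdist /sqnorm dotE.
by apply: eq_bigr => k _; rewrite !mxE expr2.
Qed.

(** Expanding |x_i - x_j|^2, the two square terms disappear because the
    coordinates of u sum to 0. *)
Lemma quad_sqdist m (X : 'M[R]_(d, m)) u : coord_sum u = 0 ->
  \sum_i \sum_j u 0 i * sqdist X i j * u 0 j = - 2 * sqnorm (u *m X).
Proof.
move=> u0; have sumu a : \sum_i u 0 i * a = 0.
  by rewrite -mulr_suml -/(coord_sum u) u0 mul0r.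
pose q i := sqnorm (row i X).
have sqE i j : sqdist X i j = q i + q j - 2 * \sum_k X i k * X j k.
  rewrite /q /sqdist /sqnorm !dotE mulr_sumr -big_split -sumrB /=.
  by apply: eq_bigr => k _; rewrite !mxE; ring.
transitivity (\sum_i u 0 i * (\sum_j u 0 j * q j)
    + \sum_i \sum_j u 0 j * (u 0 i * q i)
    - 2 * \sum_i \sum_j \sum_k u 0 i * X i k * (u 0 j * X j k)).
  rewrite mulr_sumr -big_split -sumrB /=; apply: eq_bigr => i _.
  rewrite !mulr_sumr -big_split -sumrB /=; apply: eq_bigr => j _.
  rewrite sqE mulrBr mulrBl !mulr_sumr; congr (_ - _); first by ring.
  by rewrite mulr_suml; apply: eq_bigr => k _; ring.
rewrite sumu big1 => [|i _]; last exact: sumu.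
rewrite !add0r mulNr /sqnorm dotE; congr (- (_ * _)).
under eq_bigr do rewrite exchange_big /=.
rewrite exchange_big /=; apply: eq_bigr => k _.
by rewrite mxE mulr_suml; apply: eq_bigr => i _; rewrite mulr_sumr.
Qed.

Lemma quad_supported K u (D D' : 'I_d -> 'I_d -> R) : supported K u ->
    {in K &, forall i j, D i j = D' i j} ->
  \sum_i \sum_j u 0 i * D i j * u 0 j = \sum_i \sum_j u 0 i * D' i j * u 0 j.
Proof.
move=> uK DD'; apply: eq_bigr => i _; apply: eq_bigr => j _.
have [iK|/uK->] := boolP (i \in K); last by rewrite !mul0r.
have [jK|/uK->] := boolP (j \in K); last by rewrite !mulr0.
by rewrite DD'.
Qed.

(** By [quad_sqdist], the length of u X is a function of the distances between the
    points that occur in it. *)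
Lemma congruent_sqnorm m n (X : 'M[R]_(d, m)) (Y : 'M[R]_(d, n)) K u :
    supported K u -> coord_sum u = 0 ->
    {in K &, forall i j, sqdist X i j = sqdist Y i j} ->
  sqnorm (u *m X) = sqnorm (u *m Y).
Proof.
move=> uK u0 XY; have := quad_supported uK XY.
by rewrite !quad_sqdist // => /mulfI; apply; rewrite oppr_eq0 pnatr_eq0.
Qed.

(** The orthogonal projection c X of x onto the affine hull of the rows of X
    indexed by K. Its coefficients solve the normal equations of [trmx_sub_gram]. *)
Lemma affine_projection m (X : 'M[R]_(d, m)) K (x : 'rV[R]_m) : K != finset.set0 ->
  exists c, [/\ supported K c, coord_sum c = 1 &
    forall u, supported K u -> coord_sum u = 0 -> dot (x - c *m X) (u *m X) = 0].
Proof.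
case/set0Pn => a aK.
pose e : 'rV[R]_d := delta_mx 0 a.
(* P maps e_i to e_i - e_a for i in K: its image is the space of vectors
   supported on K whose coordinates sum to 0. *)
pose P : 'M[R]_d := \matrix_(i, j) ((i \in K)%:R * ((i == j)%:R - (a == j)%:R)).
have PE w : w *m P = \sum_(i in K) w 0 i *: (delta_mx 0 i - e).
  apply/rowP => j; rewrite mxE summxE [RHS]big_mkcond; apply: eq_bigr => i _.
  rewrite !mxE !eqxx /=; case: ifP => _; last by rewrite mul0r mulr0.
  by rewrite mul1r ![j == _]eq_sym.
have Psupp w : supported K (w *m P).
  move=> i iK; rewrite PE summxE big1 // => j jK.
  by rewrite mxE (supportedB (supported_delta jK) (supported_delta aK)) ?mulr0.
have Psum w : coord_sum (w *m P) = 0.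
  rewrite PE; elim/big_ind: _ => [|u v u0 v0|i iK].
  - by rewrite /coord_sum big1 // => i _; rewrite mxE.
  - by rewrite coord_sumD u0 v0 addr0.
  - by rewrite coord_sumZ coord_sumB !coord_sum_delta subrr mulr0.
have Pid u : supported K u -> coord_sum u = 0 -> u *m P = u.
  move=> uK u0; rewrite PE.
  transitivity (\sum_i u 0 i *: (delta_mx 0 i - e)).
    rewrite [LHS]big_mkcond; apply: eq_bigr => i _; case: ifPn => // /uK ->.
    by rewrite scale0r.
  under eq_bigr do rewrite scalerBr.
  rewrite sumrB -scaler_suml -/(coord_sum u) u0 scale0r subr0.
  by rewrite -row_sum_delta.
pose B := P *m X.
have /submxP[w wE] : ((x - row a X) *m B^T <= B *m B^T)%MS.
  exact: submx_trans (submxMl _ _) (trmx_sub_gram B).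
exists (w *m P + e); split.
- move=> i iK; rewrite mxE Psupp // add0r.
  exact: (supported_delta aK).
- by rewrite coord_sumD Psum coord_sum_delta add0r.
- move=> u uK u0; rewrite -(Pid u uK u0) -mulmxA -/B.
  rewrite mulmxDl -mulmxA -/B -rowE opprD addrCA addrC.
  rewrite /dot trmx_mul mulmxA mulmxDl addrC mulNmx (addrC (- _)) wE.
  by rewrite mulmxA subrr mul0mx mxE.
Qed.

End Points.

(** * Completion along an elimination order *)

Section Completion.
Variables (R : realType) (d : nat).
Implicit Types (K T : {set 'I_d}) (u c : 'rV[R]_d) (G H : graph d).

Lemma sqdistxx m (X : 'M[R]_(d, m)) i : sqdist X i i = 0.
Proof. by rewrite /sqdist subrr /sqnorm /dot mul0mx mxE. Qed.

Lemma sqdistC m (X : 'M[R]_(d, m)) i j : sqdist X i j = sqdist X j i.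
Proof.
rewrite /sqdist /sqnorm !dotE; apply: eq_bigr => k _.
by rewrite !mxE -!expr2 -sqrrN opprB.
Qed.

(** The coefficients c locate the foot of the perpendicular from the point v to the
    affine hull of the points of K, and h is its length, positive by affine
    independence. If K is empty, any height will do. *)
Lemma sqdist_coordinates m (X : 'M[R]_(d, m)) v K :
    v \notin K -> affinely_independent X (v |: K)%SET ->
  exists c, exists2 h : R, 0 < h & supported K c /\ {in K, forall a,
    coord_sum (c - delta_mx 0 a) = 0 /\
    sqdist X v a = sqnorm ((c - delta_mx 0 a) *m X) + h ^+ 2}.
Proof.
move=> vK indX; have [->|Kn0] := eqVneq K finset.set0.
  exists 0, 1; rewrite ?ltr01 //; split=> [i _|a]; first by rewrite mxE.
  by rewrite inE.
have [c [cK c1 cX]] := affine_projection X (row v X) Kn0.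
set p := row v X - c *m X in cX.
have pn0 : p != 0.
  apply/eqP => p0; pose u : 'rV[R]_d := delta_mx 0 v - c.
  have /rowP/(_ v)/eqP : u = 0.
    apply: indX.
    - apply: supportedB; first by apply: supported_delta; rewrite setU11.
      by apply: supportedS cK; apply: finset.subsetUr.
    - by rewrite mulmxBl -rowE.
    - by rewrite coord_sumB coord_sum_delta c1 subrr.
  by rewrite !mxE !eqxx cK // subr0 oner_eq0.
have p_gt0 : 0 < sqnorm p.
  by rewrite lt0r sqnorm_ge0 andbT; apply: contra_neq pn0 => /sqnorm_eq0.
exists c, (Num.sqrt (sqnorm p)); rewrite ?sqrtr_gt0 //; split => // a aK.
have u0 : coord_sum (c - delta_mx 0 a) = 0.
  by rewrite coord_sumB c1 coord_sum_delta subrr.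
split => //; rewrite sqr_sqrtr ?sqnorm_ge0 // addrC -sqnormD_orth; last first.
  by apply: cX => //; apply: supportedB => //; apply: supported_delta.
by rewrite /sqdist /p mulmxBl -rowE addrA subrK.
Qed.

(** Column j of Y is the axis introduced when the vertex j is added, so that the
    rows indexed by T vanish outside the columns indexed by T. *)
Lemma euclidean_completion m (X : 'M[R]_(d, m)) H T : chordal H ->
    (forall K, clique H K -> affinely_independent X K) ->
  exists Y : 'M[R]_d, [/\ forall i j, i \in T -> j \notin T -> Y i j = 0,
    forall u, supported T u -> u *m Y = 0 -> u = 0 &
    {in T &, forall i j, adj H i j -> sqdist Y i j = sqdist X i j}].
Proof.
move=> chH indX; have [n] := ubnP #|T|; elim: n T => // n IHn T.
rewrite ltnS => Tn; have [->|/(chordal_simplicial chH)[v vT simv]] :=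
    eqVneq T finset.set0.
  exists 0; split=> [i j|u u0 _|i j]; rewrite ?inE //.
  by apply/rowP => i; rewrite u0 ?inE // mxE.
pose T' := (T :\ v)%SET.
have T'n : (#|T'| < n)%N by apply: leq_trans Tn; rewrite (cardsD1 v T) vT.
have [Y' [Y'0 Y'free Y'X]] := IHn _ T'n.
pose N := [set a in T' | adj H v a]%SET.
have NT' : N \subset T' by apply/fintype.subsetP => a; rewrite inE => /andP[].
have T'T : T' \subset T by apply: finset.subsetDl.
have vN : v \notin N by rewrite !inE eqxx.
have NP a : a \in N -> [/\ a \in T, a \in T' & adj H v a].
  by rewrite !inE => /andP[/andP[-> ->] ->].
have Nadj : {in N &, forall a b, a != b -> adj H a b}.
  by move=> a b /NP[aT _ va] /NP[bT _ vb]; apply: simv.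
have cliqueN : clique H (v |: N)%SET.
  apply/forall_inP => a; rewrite in_setU1 => aN.
  apply/forall_inP => b; rewrite in_setU1 => bN.
  apply/implyP => ab; case/predU1P: aN bN ab => [->|aN] /predU1P[->|bN] ab.
  - by rewrite eqxx in ab.
  - by have [] := NP _ bN.
  - by rewrite adjC; have [] := NP _ aN.
  - exact: Nadj.
have [c [h h_gt0 [cN cX]]] := sqdist_coordinates vN (indX _ cliqueN).
pose Y : 'M[R]_d := \matrix_i
  (if i == v then c *m Y' + h *: delta_mx 0 v else row i Y').
have rowYv : row v Y = c *m Y' + h *: delta_mx 0 v by rewrite rowK eqxx.
have rowY i : i != v -> row i Y = row i Y' by move=> iv; rewrite rowK (negPf iv).
have T'v u : supported T' u -> (u *m Y') 0 v = 0.
  move=> uT'; rewrite mxE big1 // => i _.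
  have [iT'|/uT'->] := boolP (i \in T'); last by rewrite mul0r.
  by rewrite Y'0 ?mulr0 // !inE eqxx.
have mulY u : supported T' u -> u *m Y = u *m Y'.
  move=> uT'; rewrite !mulmx_sum_row; apply: eq_bigr => i _.
  have [->|iv] := eqVneq i v; first by rewrite uT' ?scale0r // !inE eqxx.
  by rewrite rowY.
have cT' := supportedS NT' cN.
have Yvv : Y v v = h.
  have := congr1 (fun r : 'rV_d => r 0 v) rowYv.
  by rewrite mxE [RHS]mxE T'v // add0r !mxE !eqxx mulr1.
have Yiv i : i \in T' -> Y i v = 0.
  rewrite !inE => /andP[iv iT].
  have := congr1 (fun r : 'rV_d => r 0 v) (rowY _ iv).
  by rewrite mxE [RHS]mxE => ->; rewrite Y'0 // !inE ?iv ?eqxx.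
(* Pythagoras' theorem on both sides: the foot of the perpendicular is the same
   affine combination of the neighbours, among which distances agree. *)
have dist_v a : a \in N -> sqdist Y v a = sqdist X v a.
  move=> aN; have [aT aT' va] := NP _ aN; have [u0 ->] := cX a aN.
  set u := c - delta_mx 0 a in u0 *.
  have uN : supported N u by apply: supportedB => //; apply: supported_delta.
  have -> : sqnorm (u *m X) = sqnorm (u *m Y').
    apply: (congruent_sqnorm uN) => // i j iN jN.
    have [->|ij] := eqVneq i j; first by rewrite !sqdistxx.
    have [_ iT' _] := NP _ iN; have [_ jT' _] := NP _ jN.
    by rewrite Y'X // Nadj.
  have av : a != v by move: aT'; rewrite !inE => /andP[].
  have -> : sqdist Y v a = sqnorm (u *m Y' + h *: delta_mx 0 v).
    by rewrite /sqdist rowYv rowY // mulmxBl -rowE addrAC.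
  have dotv (w : 'rV[R]_d) : dot w (h *: delta_mx 0 v) = h * w 0 v.
    rewrite dotE (bigD1 v) //= !mxE !eqxx mulr1 mulrC big1 ?addr0 // => i iv.
    by rewrite !mxE (negPf iv) andbF !mulr0.
  rewrite sqnormD_orth; last by rewrite dotv T'v ?mulr0 //; apply: supportedS uN.
  by rewrite [sqnorm (_ *: _)]dotv !mxE !eqxx mulr1 expr2.
exists Y; split.
- move=> i j iT jT; have jT' : j \notin T' by apply: contra jT => /(fintype.subsetP T'T).
  have jv : j != v by apply: contraNneq jT => ->.
  have [->|iv] := eqVneq i v.
    have := congr1 (fun r : 'rV_d => r 0 j) rowYv.
    rewrite mxE [RHS]mxE => ->; rewrite mxE big1 => [|k _].
      by rewrite !mxE (negPf jv) andbF mulr0 addr0.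
    have [kT'|/cT'->] := boolP (k \in T'); last by rewrite mul0r.
    by rewrite Y'0 ?mulr0.
  have := congr1 (fun r : 'rV_d => r 0 j) (rowY _ iv).
  by rewrite mxE [RHS]mxE => ->; rewrite Y'0 // !inE iv.
- move=> u uT uY; have uv : u 0 v = 0.
    have /eqP := congr1 (fun r : 'rV_d => r 0 v) uY.
    rewrite mxE [in X in _ == X]mxE (bigD1 v) //= big1 ?addr0 => [|i iv].
      by rewrite Yvv mulf_eq0 (gt_eqF h_gt0) orbF => /eqP.
    have [iT|/uT->] := boolP (i \in T); last by rewrite mul0r.
    by rewrite Yiv ?mulr0 // !inE iv.
  have uT' : supported T' u.
    move=> i; rewrite !inE negb_and negbK => /orP[/eqP->//|]; exact: uT.
  by apply: Y'free => //; rewrite -mulY.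
- move=> i j iT jT ij; have [iv|iv] := eqVneq i v.
    subst i; apply: dist_v; rewrite !inE jT ij !andbT.
    by apply: contraTneq ij => ->; rewrite adjxx.
  have [jv|jv] := eqVneq j v.
    by subst j; rewrite sqdistC [RHS]sqdistC dist_v // !inE iT iv adjC.
  by rewrite /sqdist !rowY // -/(sqdist _ _ _) Y'X // !inE ?iv ?jv.
Qed.

Lemma mulmx_quad (D : 'M[R]_d) (v : 'cV[R]_d) :
  (v^T *m D *m v) 0 0 = \sum_i \sum_j v^T 0 i * D i j * v^T 0 j.
Proof.
rewrite mxE exchange_big /=; apply: eq_bigr => j _.
by rewrite mxE mulr_suml; apply: eq_bigr => i _; rewrite !mxE.
Qed.

Lemma variogram_strictly_cnd n (Y : 'M[R]_(d, n)) :
  affinely_independent Y finset.setT -> strictly_cnd (variogram (Y *m Y^T)).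
Proof.
move=> indY; split.
- by apply/matrixP => i j; rewrite mxE !variogram_gram sqdistC.
- by move=> i; rewrite variogram_gram sqdistxx.
move=> v vn0 v0.
have s0 : coord_sum v^T = 0.
  by rewrite -[RHS]v0; apply: eq_bigr => i _; rewrite mxE.
rewrite mulmx_quad; under eq_bigr do under eq_bigr do rewrite variogram_gram.
rewrite quad_sqdist // mulNr oppr_lt0 mulr_gt0 // lt0r sqnorm_ge0 andbT.
apply: contra_neq vn0 => /sqnorm_eq0 /indY vT.
rewrite -[v]trmxK vT ?trmx0 // => i; rewrite inE //.
Qed.

Lemma chordal_cover_completion m (X : 'M[R]_(d, m)) G H : chordal H ->
    edges G \subset edges H ->
    (forall K, clique H K -> affinely_independent X K) ->
  exists Gamma, strictly_cnd_completion G (variogram (centered_gram X)) Gamma.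
Proof.
move=> chH GH /(euclidean_completion finset.setT chH)[Y [_ Yfree YX]].
exists (variogram (Y *m Y^T)); split.
  by apply: variogram_strictly_cnd => u uT uY _; apply: Yfree.
move=> i j ij; rewrite variogram_gram variogram_centered_gram_sqdist.
by apply: YX; rewrite ?inE //; apply: (fintype.subsetP GH).
Qed.

(** More than m + 1 points in dimension m are affinely dependent. *)
Lemma no_completion m (X : 'M[R]_(d, m)) G K : clique G K ->
    (m.+1 < #|K|)%N ->
  ~ exists Gamma, strictly_cnd_completion G (variogram (centered_gram X)) Gamma.
Proof.
move=> cK mK [Gamma [[_ Gamma0 Gammaneg] GammaX]].
pose f : 'I_#|K| -> 'I_d := enum_val.
pose M := rowsub f (row_mx X (const_mx 1 : 'cV_d)).
have /rowV0Pn[w wM wn0] : kermx M != 0.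
  rewrite -mxrank_eq0 mxrank_ker subn_eq0 -ltnNge.
  by apply: leq_ltn_trans mK; apply: leq_trans (rank_leq_col M) _; rewrite addn1.
move/sub_kermxP: wM; rewrite /M rowsubE mulmxA.
set u := w *m _; rewrite mul_mx_row => /eqP; rewrite row_mx_eq0 => /andP[/eqP uX u1].
have fK k : f k \in K by apply: enum_valP.
have uf k : u 0 (f k) = w 0 k.
  rewrite mxE (bigD1 k) //= !mxE eqxx mulr1 big1 ?addr0 // => l lk.
  by rewrite !mxE (inj_eq enum_val_inj) (negPf lk) mulr0.
have uK : supported K u.
  move=> i iK; rewrite mxE big1 // => k _; rewrite !mxE.
  by have [fi|] := eqVneq; [rewrite -fi fK in iK | rewrite mulr0].
have u0 : coord_sum u = 0.
  move/eqP/rowP/(_ 0): u1; rewrite [LHS]mxE [RHS]mxE => <-.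
  by apply: eq_bigr => i _; rewrite [const_mx _ _ _]mxE mulr1.
have un0 : u^T != 0.
  rewrite trmx_eq0; apply: contra_neq wn0 => uE; apply/rowP => k.
  by rewrite -uf uE !mxE.
have := Gammaneg _ un0; rewrite mulmx_quad trmxK.
rewrite (quad_supported (K := K) (D' := sqdist X) uK); last first.
  move=> i j iK jK; have [->|ij] := eqVneq i j; first by rewrite Gamma0 sqdistxx.
  rewrite GammaX ?variogram_centered_gram_sqdist //.
  by move/forall_inP: cK => /(_ _ iK)/forall_inP/(_ _ jK)/implyP; apply.
rewrite quad_sqdist // uX /sqnorm /dot mul0mx mxE mulr0 ltxx.
suff sumu : \sum_i u^T i 0 = 0 by move/(_ sumu).
by rewrite -[RHS]u0; apply: eq_bigr => i _; rewrite mxE.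
Qed.

End Completion.

(** * Zeros of separately affine functions *)

Section Null.
Local Open Scope classical_set_scope.
Variable R : realType.
Local Notation T := (measurableTypeR R).

(** The function c |-> F (x + c e_k) is affine, expressed by its values at 0 and 1. *)
Definition separately_affine n (F : 'rV[R]_n -> R) := forall k x c,
  F (x + c *: delta_mx 0 k) = F x + c * (F (x + delta_mx 0 k) - F x).

Definition row_of_tuple n (t : n.-tuple T) : 'rV[R]_n := \row_k tnth t k.

Definition row_cons n (a : R) (y : 'rV[R]_n) : 'rV[R]_n.+1 :=
  \row_k (if unlift ord0 k is Some l then y 0 l else a).

Lemma row_of_tuple_cons n (p : n.-tuple T * T) :
  row_of_tuple (tuple_cons p) = row_cons p.2 (row_of_tuple p.1).
Proof.
by apply/rowP => k; rewrite !mxE; case: unliftP => [l|] ->; rewrite ?tnthS ?mxE.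
Qed.

Lemma row_cons_affine n a (y : 'rV[R]_n) :
  row_cons a y = row_cons 0 y + a *: delta_mx 0 ord0.
Proof.
apply/rowP => k; rewrite !mxE eqxx /=.
by case: unliftP => [l|] ->; rewrite ?eqxx ?mulr1 ?add0r // mulr0 addr0.
Qed.

Lemma row_cons_delta n a c k (y : 'rV[R]_n) :
  row_cons a (y + c *: delta_mx 0 k) =
  row_cons a y + c *: delta_mx 0 (lift ord0 k).
Proof.
apply/rowP => j; rewrite !mxE eqxx /=.
case: unliftP => [l|] ->; first by rewrite !mxE eqxx (inj_eq lift_inj).
by rewrite (negPf (neq_lift _ _)) mulr0 addr0.
Qed.

Section Step.
Variables (n : nat) (F : 'rV[R]_n.+1 -> R).
Hypothesis affF : separately_affine F.

Definition slope (y : 'rV[R]_n) := F (row_cons 1 y) - F (row_cons 0 y).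

Lemma row_cons_slope a y : F (row_cons a y) = F (row_cons 0 y) + a * slope y.
Proof.
by rewrite row_cons_affine affF /slope (row_cons_affine 1) scale1r.
Qed.

Lemma separately_affine_row_cons a : separately_affine (F \o row_cons a).
Proof.
move=> k x c /=; rewrite row_cons_delta affF.
by have := row_cons_delta a 1 k x; rewrite !scale1r => ->.
Qed.

Lemma separately_affine_slope : separately_affine slope.
Proof.
move=> k x c; rewrite /slope.
have /= -> := separately_affine_row_cons 1 k x c.
have /= -> := separately_affine_row_cons 0 k x c.
by ring.
Qed.

End Step.

Lemma measurable_separately_affine n (F : 'rV[R]_n -> R) :
  separately_affine F -> measurable_fun setT (F \o @row_of_tuple n).
Proof.
elim: n F => [F _|n IHn F affF].
  rewrite (_ : _ \o _ = cst (F 0)); first exact: measurable_cst.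
  by apply/funext => t /=; congr F; apply/rowP; case.
pose tl (t : n.+1.-tuple T) : n.-tuple T := [tuple tnth t (lift ord0 i) | i < n].
have tupleE t : t = tuple_cons (tl t, tnth t ord0).
  apply/eq_from_tnth => i; case: (unliftP ord0 i) => [j|] ->; last by [].
  by rewrite tnthS tnth_mktuple.
have mtl : measurable_fun setT tl.
  apply/measurable_fun_tnthP => i.
  rewrite (_ : _ \o _ = @tnth _ _ ^~ (lift ord0 i)); first exact: measurable_tnth.
  by apply/funext => t /=; rewrite tnth_mktuple.
rewrite (_ : _ \o _ = fun t => F (row_cons 0 (row_of_tuple (tl t))) +
    (tnth t ord0 : R) * slope F (row_of_tuple (tl t))); last first.
  apply/funext => t /=; rewrite {1}(tupleE t) row_of_tuple_cons.
  exact: row_cons_slope.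
apply: measurable_funD.
  apply: (@measurableT_comp _ _ _ _ _ _ ((F \o row_cons 0) \o @row_of_tuple n)) => //.
  by apply: IHn; apply: separately_affine_row_cons.
apply: measurable_funM; first exact: measurable_tnth.
apply: (@measurableT_comp _ _ _ _ _ _ (slope F \o @row_of_tuple n)) => //.
by apply: IHn; apply: separately_affine_slope.
Qed.

Lemma measurable_zeros n (F : 'rV[R]_n -> R) : separately_affine F ->
  measurable [set t : n.-tuple T | F (row_of_tuple t) = 0].
Proof.
move=> affF; rewrite (_ : mkset _ = setT `&` (F \o @row_of_tuple n) @^-1` [set 0]).
  exact: measurable_separately_affine.
by rewrite setTI.
Qed.

(** Write F (a, y) = F (0, y) + a * slope F y. If the slope is not identically zero
    then, for almost all y, there is at most one zero a; otherwise F (0, y) is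
    nonzero for almost all y, and there is none. *)
Lemma zeros_null n (F : 'rV[R]_n -> R) : separately_affine F ->
    (exists x, F x != 0) ->
  lebesgue_tuple R n [set t | F (row_of_tuple t) = 0] = 0%E.
Proof.
elim: n F => [F _ [x Fx]|n IHn F affF [x Fx]].
  rewrite (_ : mkset _ = set0) ?measure0 // -subset0 => t /=.
  by rewrite (_ : row_of_tuple t = x) => [/eqP|]; [rewrite (negPf Fx)|apply/rowP; case].
set Z := mkset _; rewrite /= /lebesgue_step /pushforward /product_measure1.
pose Z' := @tuple_cons R n @^-1` Z.
have mZ' : measurable Z'.
  rewrite -[Z']setTI; apply: measurable_tuple_cons => //.
  exact: measurable_zeros.
suff [N [mN N0 NZ]] : (lebesgue_tuple R n).-negligible
    [set t | lebesgue_measure (xsection Z' t) <> 0%E].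
  rewrite (@ae_eq_integral _ _ _ _ setT (cst 0%E)) ?integral0 //.
  - exact: measurable_fun_xsection.
  - by exists N; split => // t /= /not_implyP[_ ht]; apply: NZ.
have Z'E t (y : T) : xsection Z' t y ->
    F (row_cons 0 (row_of_tuple t)) + y * slope F (row_of_tuple t) = 0.
  by rewrite /xsection /= inE /Z' /Z /= row_of_tuple_cons row_cons_slope.
have [[y Fy]|F10] := pselect (exists y, slope F y != 0).
  exists [set t | slope F (row_of_tuple t) = 0]; split.
  - by apply: measurable_zeros; apply: separately_affine_slope.
  - by apply: IHn; [apply: separately_affine_slope | exists y].
  - move=> t /=; apply: contra_notP => /eqP Ft.
    apply/eqP; rewrite -measure_le0 -(lebesgue_measure_set1
      (- F (row_cons 0 (row_of_tuple t)) / slope F (row_of_tuple t))).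
    rewrite le_measure ?inE //; first exact: measurable_xsection.
    move=> z /Z'E /eqP; rewrite addrC addr_eq0 => /eqP zE /=.
    by rewrite -zE mulfK.
exists [set t | F (row_cons 0 (row_of_tuple t)) = 0]; split.
- by apply: (@measurable_zeros _ (F \o row_cons 0)); apply: separately_affine_row_cons.
- apply: (IHn (F \o row_cons 0)); first exact: separately_affine_row_cons.
  pose y : 'rV[R]_n := \row_k x 0 (lift ord0 k).
  exists y; apply: contraNneq Fx => /= F0.
  rewrite (_ : x = row_cons (x 0 ord0) y); last first.
    by apply/rowP => k; rewrite mxE; case: unliftP => [l|] -> //; rewrite mxE.
  rewrite row_cons_slope // F0 add0r mulf_eq0; apply/orP; right.
  by apply/negPn/negP => s0; apply: F10; exists y.
- move=> t /=; apply: contra_notP => Ft.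
  rewrite (_ : xsection _ _ = set0) ?measure0 // -subset0 => z /Z'E.
  suff -> : slope F (row_of_tuple t) = 0 by rewrite mulr0 addr0.
  by apply/eqP/negPn/negP => s0; apply: F10; exists (row_of_tuple t).
Qed.

Lemma lebesgue_tuple_setT_gt0 n : (0 < lebesgue_tuple R n setT)%E.
Proof.
elim: n => [|n IHn]; first by rewrite /= diracT lte01.
rewrite /= /lebesgue_step /pushforward preimage_setT -setXTT.
rewrite product_measure1E //; apply: mule_gt0 => //.
have /lt_le_trans : (0 < @lebesgue_measure R `[0%R, 1%R]%classic)%E.
  by rewrite lebesgue_measure_itv /= lte_fin ltr01 oppr0 adde0 lte01.
by apply; apply: le_measure; rewrite ?inE.
Qed.

End Null.

(** * Points in general position *)

Section GeneralPosition.
Variables (R : realType) (d m : nat).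
Implicit Types (X : 'M[R]_(d, m)) (f : 'I_(m + 1) -> 'I_d).

(** A linear dependence between the rows (x_i, 1) is an affine dependence between
    the points x_i. *)
Definition affine_minor f X : R :=
  \det (rowsub f (row_mx X (const_mx 1 : 'cV_d))).

Lemma det_affine_row n (M N : 'M[R]_n) r c :
    (forall s, s != r -> row s N = 0) ->
  \det (M + c *: N) = \det M + c * (\det (M + N) - \det M).
Proof.
move=> N0; have lift0 s j : N (lift r s) j = 0.
  have /N0/rowP/(_ j) : lift r s != r by rewrite eq_sym neq_lift.
  by rewrite !mxE.
rewrite (@determinant_multilinear _ _ _ M (M + N) r (1 - c) c); first by ring.
- by apply/rowP => j; rewrite !mxE; ring.
- by apply/matrixP => s j; rewrite !mxE lift0 mulr0 addr0.
- by apply/matrixP => s j; rewrite !mxE lift0 mulr0.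
Qed.

(** Changing one coordinate of one point modifies at most one row of the matrix, as
    f is injective. *)
Lemma separately_affine_minor f : injective f ->
  separately_affine (fun x => affine_minor f (vec_mx x)).
Proof.
move=> f_inj k x c; case/mxvec_indexP: k => i j.
pose N := rowsub f (row_mx (delta_mx i j) (0 : 'cV[R]_d)).
have E a : rowsub f (row_mx (vec_mx (x + a *: delta_mx 0 (mxvec_index i j)))
      (const_mx 1 : 'cV_d)) =
    rowsub f (row_mx (vec_mx x) (const_mx 1 : 'cV_d)) + a *: N.
  rewrite linearD linearZ /= vec_mx_delta /N; apply/matrixP => p q.
  by rewrite !mxE; case: splitP => l _; rewrite !mxE ?mulr0 ?addr0.
have := E 1; rewrite !scale1r /affine_minor => ->; rewrite E.
have [r fr] : exists r, forall s, s != r -> f s != i.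
  have [r /eqP fr|no] := pickP (fun r => f r == i).
    by exists r => s sr; rewrite -fr (inj_eq f_inj).
  (* The modified point is not among the selected ones: any row will do. *)
  by exists (rshift m ord0) => s _; rewrite no.
apply: (@det_affine_row _ _ _ r) => s /fr fs; apply/rowP => q; rewrite !mxE.
by case: splitP => l _; rewrite !mxE // (negPf fs).
Qed.

(** The minor is 1 at the origin and the unit vectors, the vertices of a simplex. *)
Lemma affine_minor_neq0 f : injective f ->
  exists x, affine_minor f (vec_mx x) != 0.
Proof.
move=> f_inj.
exists (mxvec (\matrix_(i, j) (f (lshift 1 j) == i)%:R)); rewrite mxvecK.
rewrite /affine_minor (_ : rowsub _ _ = block_mx 1%:M (const_mx 1) 0 1%:M).
  by rewrite det_ublock !det1 mulr1 oner_neq0.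
apply/matrixP => p q; rewrite [LHS]mxE.
case: (split_ordP p) => k ->; case: (split_ordP q) => l ->.
- by rewrite row_mxEl block_mxEul !mxE (inj_eq f_inj) eq_sym (inj_eq (@lshift_inj _ _)).
- by rewrite row_mxEr block_mxEur !mxE.
- by rewrite row_mxEl block_mxEdl !mxE (inj_eq f_inj) eq_lrshift.
- by rewrite row_mxEr block_mxEdr !mxE !ord1.
Qed.

Lemma affine_minor_independent f X (K : {set 'I_d}) : affine_minor f X != 0 ->
  {subset K <= codom f} -> affinely_independent X K.
Proof.
move=> detX Kf u uK uX u0; pose w : 'rV[R]_(m + 1) := \row_k u 0 (f k).
have f_inj : injective f.
  move=> k l fkl; apply/eqP; apply: contraNT detX => kl.
  by apply/eqP/(determinant_alternate kl) => j; rewrite !mxE fkl.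
have uE : u = w *m rowsub f 1%:M.
  apply/rowP => i; rewrite mxE; have [/codomP[k ->]|iNf] := boolP (i \in codom f).
    rewrite (bigD1 k) //= !mxE eqxx mulr1 big1 ?addr0 // => l lk.
    by rewrite !mxE (inj_eq f_inj) (negPf lk) mulr0.
  rewrite big1 ?uK //; first by apply: contra iNf => /Kf.
  move=> k _; rewrite !mxE; case: eqP => [fk|_]; last by rewrite mulr0.
  by rewrite -fk codom_f in iNf.
suff w0 : w = 0 by rewrite uE w0 mul0mx.
have wM : w *m rowsub f (row_mx X (const_mx 1 : 'cV_d)) = 0.
  rewrite rowsubE mulmxA -uE mul_mx_row uX.
  rewrite (_ : u *m const_mx 1 = 0) ?row_mx0 //.
  apply/rowP => j; rewrite mxE [RHS]mxE -[RHS]u0.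
  by apply: eq_bigr => i _; rewrite mxE mulr1.
rewrite -[w](mulmxK (_ : rowsub f (row_mx X (const_mx 1 : 'cV_d)) \in unitmx)).
  by rewrite wM mul0mx.
by rewrite unitmxE unitfE.
Qed.

(** Centering subtracts multiples of the column of ones from the columns of X. So
    it does not change the column space of (X, 1), which has dimension m + 1, and
    the centered X has rank at least m. *)
Lemma affine_minor_rank f X : affine_minor f X != 0 ->
  \rank (centered_gram X) = m.
Proof.
move=> detX; rewrite /centered_gram mxrank_gram.
apply/eqP; rewrite eqn_leq rank_leq_col /= -(leq_add2r 1).
pose b : 'rV[R]_m := const_mx d%:R^-1 *m X.
have XE : row_mx X (const_mx 1 : 'cV_d) =
    row_mx (centering R d *m X) (const_mx 1) *m block_mx 1%:M 0 b 1%:M.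
  rewrite mul_row_block !mulmx1 mulmx0 add0r; congr row_mx.
  rewrite /b mulmxA (_ : const_mx 1 *m _ = const_mx d%:R^-1); last first.
    by apply/matrixP => i j; rewrite !mxE big_ord1 !mxE mul1r.
  by rewrite -mulmxDl /centering subrK mul1mx.
apply: (@leq_trans (\rank (row_mx X (const_mx 1 : 'cV[R]_d)))).
  have /eqP rankf : row_free (rowsub f (row_mx X (const_mx 1 : 'cV_d))).
    by rewrite row_free_unit unitmxE unitfE.
  by rewrite -[leqLHS]rankf rowsubE mxrankM_maxr.
rewrite XE; apply: leq_trans (mxrankM_maxl _ _) _.
rewrite -mxrank_tr tr_row_mx -addsmxE.
apply: leq_trans (mxrank_adds_leqif _ _) _; rewrite mxrank_tr leq_add2l.
exact: rank_leq_row.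
Qed.

Lemma centered_gram_psd X : (0 < d)%N ->
  centered_psd_of_rank (\rank (centered_gram X)) (centered_gram X).
Proof.
move=> d_gt0; split=> //.
  split=> [|v]; first by rewrite /centered_gram trmx_mul trmxK.
  have := sqnorm_ge0 (v^T *m (centering R d *m X)).
  by rewrite /sqnorm /dot trmx_mul trmxK /centered_gram !mulmxA.
rewrite /centered_gram trmx_mul -!mulmxA.
rewrite (_ : (centering R d)^T *m const_mx 1 = 0) ?mulmx0 //.
apply/colP => i; rewrite mxE.
transitivity (\sum_j ((i == j)%:R - d%:R^-1 : R)).
  by apply: eq_bigr => j _; rewrite !mxE mulr1 eq_sym.
rewrite sumrB (bigD1 i) //= eqxx big1 ?addr0 => [|j]; last first.
  by rewrite eq_sym => /negPf ->.
rewrite big_const_ord iter_addr_0 -[_ *+ d]mulr_natr mulVf ?subrr ?mxE //.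
by rewrite pnatr_eq0 -lt0n.
Qed.

End GeneralPosition.

Section Generic.
Local Open Scope classical_set_scope.
Variables (R : realType) (d : nat).

Lemma affine_minor_null m (f : 'I_(m + 1) -> 'I_d) : injective f ->
  (lebesgue_tuple R (d * m)).-negligible [set t | affine_minor f (config t) = 0].
Proof.
move=> f_inj; have affF := @separately_affine_minor R d m f f_inj.
apply/negligibleP; first exact: measurable_zeros affF.
by apply: (zeros_null affF); apply: affine_minor_neq0.
Qed.

Lemma negligible_finite_union (disp : measure_display) (T : measurableType disp)
    (mu : {measure set T -> \bar R}) (I : finType) (P : pred I) (F : I -> set T) :
    (forall i, P i -> mu.-negligible (F i)) ->
  mu.-negligible [set t | exists2 i, P i & F i t].
Proof.
move=> F0; have : mu.-negligible (\big[setU/set0]_(i | P i) F i).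
  by elim/big_ind: _ => //; [exact: negligible_set0|exact: negligibleU].
apply: negligibleS => t [i Pi Fit].
by rewrite (bigD1 i) //=; left.
Qed.

Lemma generic_affine_minors m :
  (lebesgue_tuple R (d * m)).-negligible
    [set t | exists2 f : {ffun 'I_(m + 1) -> 'I_d},
      injectiveb f & affine_minor f (config t) = 0].
Proof.
by apply: negligible_finite_union => f /injectiveP; apply: affine_minor_null.
Qed.

Lemma subset_codom_injective m (K : {set 'I_d}) : (m < d)%N -> (#|K| <= m.+1)%N ->
  exists2 f : {ffun 'I_(m + 1) -> 'I_d}, injectiveb f & {subset K <= codom f}.
Proof.
move=> md Km; pose s := enum K ++ enum (~: K)%SET.
have sz_s : size s = d by rewrite size_cat -!cardE cardsC card_ord.
have us : uniq s.
  rewrite cat_uniq !enum_uniq andbT /=; apply/hasPn => i.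
  by rewrite !mem_enum inE.
have i0 : 'I_d by exists 0%N; apply: leq_trans md.
have ms (k : 'I_(m + 1)) : (k < size s)%N.
  by rewrite sz_s; apply: leq_trans md; rewrite -[leqRHS]addn1.
exists [ffun k : 'I_(m + 1) => nth i0 s k].
  apply/injectiveP => k l; rewrite !ffunE => /eqP.
  by rewrite nth_uniq // => /eqP/val_inj.
move=> i iK; have ik : (index i (enum K) < m + 1)%N.
  rewrite addn1; apply: leq_trans Km.
  by rewrite cardE index_mem mem_enum.
apply/codomP; exists (Ordinal ik); rewrite ffunE /= nth_cat index_mem mem_enum iK.
by rewrite nth_index ?mem_enum.
Qed.

Lemma clique_number_le (G : graph d) (K : {set 'I_d}) :
  clique G K -> (#|K| <= clique_number G)%N.
Proof. exact: (@leq_bigmax_cond _ _ (fun S : {set 'I_d} => #|S|)). Qed.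

Lemma clique_number_witness (G : graph d) :
  exists2 K, clique G K & #|K| = clique_number G.
Proof.
have c0 : clique G finset.set0 by apply/forall_inP => i; rewrite inE.
have [|K cK KE] := @eq_bigmax_cond _ (clique G) (fun K : {set 'I_d} => #|K|).
  by apply/card_gt0P; exists finset.set0.
by exists K; rewrite // /clique_number KE.
Qed.

Lemma treewidth_cover (G : graph d) : exists H : graph d,
  [/\ chordal H, edges G \subset edges H & (clique_number H).-1 = treewidth G].
Proof.
rewrite /treewidth; case: arg_minnP => [|H /asboolP[GH chH] _].
  exact: chordal_cover_complete.
by exists H.
Qed.

Lemma treewidth_lt (G : graph d) : (0 < d)%N -> (treewidth G < d)%N.
Proof.
move=> d_gt0; have [H [_ _ <-]] := treewidth_cover G.
apply: (@leq_ltn_trans d.-1); last by rewrite ltn_predL.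
rewrite -!subn1 leq_sub2r //; have [K _ <-] := clique_number_witness H.
by rewrite -[leqRHS]card_ord max_card.
Qed.

Lemma treewidth_completable (G : graph d) : (0 < d)%N ->
  generically_completable R G (treewidth G).
Proof.
move=> d_gt0; have td := treewidth_lt G d_gt0; split => //.
apply: negligibleS (generic_affine_minors _) => t /= [_].
apply: contra_notP => minors.
have [H [chH GH twE]] := treewidth_cover G.
apply: (chordal_cover_completion chH GH) => K cK.
have [|f f_inj Kf] := @subset_codom_injective _ K td.
  rewrite -twE; apply: leq_trans (clique_number_le cK) (leqSpred _).
apply: affine_minor_independent Kf; apply/negP => /eqP f0.
by apply: minors; exists f.
Qed.

(** If m is too small, no configuration of rank m can be completed. The other
    configurations annihilate a minor, so the whole space would be null. *)
Lemma completable_ge_clique (G : graph d) m :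
  generically_completable R G m -> ((clique_number G).-1 <= m)%N.
Proof.
move=> [md gen]; rewrite leqNgt; apply/negP => mq.
have [K cK KE] := clique_number_witness G.
have mK : (m.+1 < #|K|)%N by rewrite KE; case: (clique_number G) mq.
have d_gt0 : (0 < d)%N by apply: leq_trans md.
have := negligibleU gen (generic_affine_minors m).
have [|f f_inj _] := @subset_codom_injective m finset.set0 md; first by rewrite cards0.
move=> /negligibleS - /(_ setT) [|A [mA A0 TA]].
  move=> t _; have [f0|fn0] := eqVneq (affine_minor f (config t)) 0.
    by right; exists f.
  left; split; last exact: no_completion cK mK.
  by rewrite -[X in centered_psd_of_rank X](affine_minor_rank fn0); apply: centered_gram_psd.
have := lebesgue_tuple_setT_gt0 R (d * m).
by rewrite (_ : setT = A) ?A0 ?ltxx //; apply/seteqP.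
Qed.

End Generic.

(** * The bounds on the threshold *)

Theorem theorem5p3 (R : realType) (d : nat) (G : graph d)
    (Gconnected : connected_graph G) (Gnoncomplete : ~ is_complete G) :
  exists2 m : nat, is_eMLT R G m &
    ((clique_number G).-1 <= m)%N /\ (m <= treewidth G)%N.
Proof.
have d_gt0 : (0 < d)%N.
  case: d G {Gconnected} Gnoncomplete => // G []; rewrite /is_complete.
  by apply/forall_inP => -[].
have tw := treewidth_completable R G d_gt0.
have ex : exists m, `[< generically_completable R G m >].
  by exists (treewidth G); apply/asboolP.
case: (ex_minnP ex) => m /asboolP compl_m min_m.
exists m; last by split; [apply: completable_ge_clique compl_m|apply/min_m/asboolP].
by split => // k compl_k; apply/min_m/asboolP.
Qed.
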